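(* Let $M$ be a smooth, compact manifold. The property in $Hom(M)$ of admitting a continuous strict Lyapunov function is generic; that is, the set of $f\in Hom(M)$ which admit a continuous strict Lyapunov function contains a countable intersection of open dense subsets of $(Hom(M),d_{\mathscr{H}})$.
   Context: Let $d$ be a metric on $M$ (compatible with its topology). $Hom(M)$ is the set of homeomorphisms of $M$, endowed here with the complete metric $$d_{\mathscr{H}}(f,g)=\max_{x\in M}\left(\max\left[d(f(x),g(x)),\,d(f^{-1}(x),g^{-1}(x))\right]\right).$$ A continuous function $u:M\to\mathbb{R}$ is a Lyapunov function for $f$ if $u(f(x))\le u(x)$ for every $x\in M$; it is strict if it is not a first integral, i.e. there exists $x\in M$ with $u(f(x))<u(x)$. *)

(* Defs.v *)
From HB Require Import structures.
From mathcomp Require Import all_boot all_order all_algebra.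
From mathcomp Require Import all_classical all_reals all_analysis.

Set Implicit Arguments.
Unset Strict Implicit.
Unset Printing Implicit Defensive.

Import Order.TTheory GRing.Theory Num.Theory.
Import numFieldNormedType.Exports.

Local Open Scope classical_set_scope.
Local Open Scope ring_scope.

(* Only meant for an open set U: derivatives and continuity are then local. *)
Fixpoint Ck_on (R : realType) (n m k : nat) (U : set 'rV[R]_n)
    (f : 'rV[R]_n -> 'rV[R]_m) : Prop :=
  {in U, continuous f} /\
  if k is k'.+1 then
    forall i : 'I_n,
      {in U, forall x, derivable f x (delta_mx 0 i)} /\
      Ck_on k' U ('D_(delta_mx 0 i) f)
  else True.

Definition smooth_on (R : realType) (n m : nat) (U : set 'rV[R]_n)
    (f : 'rV[R]_n -> 'rV[R]_m) : Prop :=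
  forall k, Ck_on k U f.

(* A homeomorphism between an open subset of M and an open subset of R^n,
   encoded by total functions whose values off these sets are irrelevant. *)
Record chart (R : realType) (n : nat) (M : topologicalType) := Chart {
  chart_dom : set M;
  chart_cod : set 'rV[R]_n;
  chart_fun :> M -> 'rV[R]_n;
  chart_inv : 'rV[R]_n -> M;
  open_chart_dom : open chart_dom;
  open_chart_cod : open chart_cod;
  chart_funS : set_fun chart_dom chart_cod chart_fun;
  chart_invS : set_fun chart_cod chart_dom chart_inv;
  chart_funK : {in chart_dom, cancel chart_fun chart_inv};
  chart_invK : {in chart_cod, cancel chart_inv chart_fun};
  chart_fun_continuous : {in chart_dom, continuous chart_fun};
  chart_inv_continuous : {in chart_cod, continuous chart_inv} }.

Definition smooth_transition (R : realType) (n : nat) (M : topologicalType)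
    (c1 c2 : chart R n M) : Prop :=
  smooth_on (chart_cod c1 `&` chart_inv c1 @^-1` chart_dom c2)
            (c2 \o chart_inv c1).

(* Smooth (C^oo) n-dimensional manifold without boundary; the smooth structure
   is the one generated by the (not necessarily maximal) atlas. *)
Record smooth_manifold (R : realType) (n : nat) (M : topologicalType) :=
  SmoothManifold {
    manifold_hausdorff : hausdorff_space M;
    manifold_second_countable : @second_countable M;
    atlas : set (chart R n M);
    atlas_cover : forall x : M, exists2 c, atlas c & chart_dom c x;
    atlas_compatible : forall c1 c2, atlas c1 -> atlas c2 ->
      smooth_transition c1 c2 }.

Record homeo (M : topologicalType) := Homeo {
  homeo_fun :> M -> M;
  homeo_inv : M -> M;
  homeo_funK : cancel homeo_fun homeo_inv;
  homeo_invK : cancel homeo_inv homeo_fun;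
  homeo_fun_continuous : continuous homeo_fun;
  homeo_inv_continuous : continuous homeo_inv }.

HB.instance Definition _ (M : topologicalType) := gen_eqMixin (homeo M).
HB.instance Definition _ (M : topologicalType) := gen_choiceMixin (homeo M).

Lemma homeo_ext (M : topologicalType) (f g : homeo M) :
  (forall x, f x = g x) -> f = g.
Proof.
case: f g => f f' fK f'K cf cf' [g g' gK g'K cg cg'] /= /funext fg.
rewrite -{}fg in gK g'K cg *.
have /funext f'g' : forall x, f' x = g' x by move=> x; rewrite -{1}(g'K x) fK.
rewrite -{}f'g' in gK g'K cg' *.
by congr Homeo; exact: Prop_irrelevance.
Qed.

Section homeo_dist.
Context (R : realType) (M : metricType R).
Implicit Types (f g h : homeo M) (x : M).

Definition homeo_pdist f g x : R :=
  Num.max (mdist (f x) (g x)) (mdist (homeo_inv f x) (homeo_inv g x)).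

(* On a nonempty compact space the supremum is a maximum: see homeo_dist_max. *)
Definition homeo_dist f g : R := sup (range (homeo_pdist f g)).

Lemma homeo_pdist_ge0 f g x : 0 <= homeo_pdist f g x.
Proof. by rewrite le_max mdist_ge0. Qed.

Lemma homeo_pdistC f g : homeo_pdist f g = homeo_pdist g f.
Proof.
apply/funext => x; rewrite /homeo_pdist metric_sym.
by congr Num.max; exact: metric_sym.
Qed.

Lemma homeo_pdist_triangle g f h x :
  homeo_pdist f h x <= homeo_pdist f g x + homeo_pdist g h x.
Proof.
rewrite ge_max; apply/andP; split.
  apply: le_trans (metric_triangle _ (g x) _) _.
  by apply: lerD; rewrite le_max lexx.
apply: le_trans (metric_triangle _ (homeo_inv g x) _) _.
by apply: lerD; rewrite le_max lexx orbT.
Qed.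

Lemma mdist_continuous (u v : M -> M) : continuous u -> continuous v ->
  continuous (fun x => mdist (u x) (v x)).
Proof.
move=> cu cv x; apply/cvgrPdist_lt => e e0.
have e20 : 0 < e / 2 by rewrite divr_gt0.
have /metricType_numDomainType.cvgrPdist_lt/(_ _ e20) hu := cu x.
have /metricType_numDomainType.cvgrPdist_lt/(_ _ e20) hv := cv x.
near=> y.
have ue : mdist (u x) (u y) < e / 2 by near: y.
have ve : mdist (v x) (v y) < e / 2 by near: y.
rewrite (splitr e) ltr_distl; apply/andP; split.
  rewrite ltrBlDr (le_lt_trans (metric_triangle _ (u x) _))//.
  rewrite (le_lt_trans (lerD (lexx _) (metric_triangle _ (v x) _)))//.
  by rewrite metric_sym addrCA ltrD2l ltrD.
rewrite (le_lt_trans (metric_triangle _ (u y) _))//.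
rewrite (le_lt_trans (lerD (lexx _) (metric_triangle _ (v y) _)))//.
by rewrite [mdist (v y) _]metric_sym addrCA ltrD2l ltrD.
Unshelve. all: by end_near. Qed.

Lemma homeo_pdist_continuous f g : continuous (homeo_pdist f g).
Proof.
move=> x; apply: (@continuous_max _ _ (fun x => mdist (f x) (g x))
  (fun x => mdist (homeo_inv f x) (homeo_inv g x)) x).
- by apply: mdist_continuous; exact: homeo_fun_continuous.
- by apply: mdist_continuous; exact: homeo_inv_continuous.
Qed.

Hypothesis cM : compact [set: M].

Lemma homeo_pdist_has_sup f g : [set: M] !=set0 ->
  has_sup (range (homeo_pdist f g)).
Proof.
move=> [x0 _]; split; first by exists (homeo_pdist f g x0), x0.
have [] := @compact_EVT_max M R (homeo_pdist f g) setT _ cM.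
- by exists x0.
- by apply: continuous_subspaceT; exact: homeo_pdist_continuous.
move=> x _ xmax; exists (homeo_pdist f g x) => _ [y _ <-].
by apply: xmax; rewrite inE.
Qed.

Lemma homeo_pdist_le f g x : homeo_pdist f g x <= homeo_dist f g.
Proof.
apply: ub_le_sup; last by exists x.
by have [] : has_sup (range (homeo_pdist f g))
  by apply: homeo_pdist_has_sup; exists x.
Qed.

Lemma homeo_dist_max f g : [set: M] !=set0 ->
  exists2 x, homeo_dist f g = homeo_pdist f g x &
    forall y, homeo_pdist f g y <= homeo_pdist f g x.
Proof.
move=> M0; have [//||x _ xmax] := @compact_EVT_max M R (homeo_pdist f g) setT _ cM.
  by apply: continuous_subspaceT; exact: homeo_pdist_continuous.
have {}xmax y : homeo_pdist f g y <= homeo_pdist f g x.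
  by apply: xmax; rewrite inE.
exists x => //; apply/eqP; rewrite eq_le homeo_pdist_le andbT.
apply: ge_sup => [|_ [y _ <-]//].
by case: (homeo_pdist_has_sup f g M0).
Qed.

(* The space Hom(M) of a compact metric space M; compactness is an argument
   so that the metric structure below can be attached to it. *)
Definition homeo_space of compact [set: M] : Type := homeo M.

HB.instance Definition _ := Choice.on (homeo_space cM).

Lemma homeo_distxx f : homeo_dist f f = 0.
Proof.
rewrite /homeo_dist; have -> : homeo_pdist f f = cst 0.
  by apply/funext => x; rewrite /homeo_pdist !mdistxx maxxx.
have [->|/set0P [x _]] := eqVneq [set: M] set0; first by rewrite image_set0 sup0.
rewrite (_ : range _ = [set 0]) ?sup1//.
by apply/seteqP; split=> [_ [y _ <-]//|_ ->]; exists x.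
Qed.

Lemma homeo_dist_positivity f g : homeo_dist f g = 0 -> f = g.
Proof.
move=> fg; apply: homeo_ext => x; apply: mdist_positivity; apply/eqP.
rewrite eq_le mdist_ge0 andbT -fg.
by apply: le_trans (homeo_pdist_le f g x); rewrite le_max lexx.
Qed.

Lemma homeo_distC f g : homeo_dist f g = homeo_dist g f.
Proof. by rewrite /homeo_dist homeo_pdistC. Qed.

Lemma homeo_dist_triangle g f h :
  homeo_dist f h <= homeo_dist f g + homeo_dist g h.
Proof.
have [M0|/set0P M0] := eqVneq [set: M] set0.
  by rewrite /homeo_dist M0 !image_set0 sup0 addr0.
apply: ge_sup => [|_ [x _ <-]]; first by case: (homeo_pdist_has_sup f h M0).
apply: le_trans (homeo_pdist_triangle g f h x) _.
by rewrite lerD// homeo_pdist_le.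
Qed.

HB.instance Definition _ := @isMetric.Build R (homeo_space cM) homeo_dist
  homeo_distxx homeo_dist_positivity homeo_distC homeo_dist_triangle.

End homeo_dist.

Definition lyapunov (R : realType) (M : topologicalType) (f : M -> M)
    (u : M -> R) : Prop :=
  continuous u /\ forall x, u (f x) <= u x.

Definition strict_lyapunov (R : realType) (M : topologicalType) (f : M -> M)
    (u : M -> R) : Prop :=
  lyapunov f u /\ exists x, u (f x) < u x.

Definition generic (T : topologicalType) (P : set T) : Prop :=
  exists U : (set T)^nat,
    (forall k, open (U k) /\ dense (U k)) /\ \bigcap_k U k `<=` P.

(* Main.v *)
Require Import Defs.
From mathcomp Require Import all_boot all_order all_algebra.
From mathcomp Require Import all_classical all_reals all_analysis.
From mathcomp Require Import ring lra.

(* A homeomorphism f has a strict Lyapunov function as soon as some iterate f^k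
   maps a closed set K into an open set W strictly contained in K: a Urysohn
   function u for f^k(K) and ~W decreases along f^k, and
   \sum_(i < k) u o f^i decreases along f. Since K is compact, having such a
   trapping region is an open condition on f. It is also dense: some orbit comes
   back to an arbitrarily small chart ball around one of its points z; composing
   f with a homeomorphism supported in that ball which squeezes most of it into
   a tiny ball around z makes the first return trap that tiny ball. *)

Set Implicit Arguments.
Unset Strict Implicit.
Unset Printing Implicit Defensive.

Import numFieldNormedType.Exports.
Import Order.TTheory GRing.Theory Num.Theory.

Local Open Scope classical_set_scope.
Local Open Scope ring_scope.

(** * From trapping regions to Lyapunov functions *)

Lemma continuous_iter (T : topologicalType) (f : T -> T) (k : nat) :
  continuous f -> continuous (iter k f).
Proof.
move=> cf; elim: k => [|k IHk] x /=; first exact: cvg_id.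
by apply: (@continuous_comp _ _ _ (iter k f) f); [exact: IHk|exact: cf].
Qed.

(** One step of [f] shifts the sum, which telescopes: its increment at [y] is that of [u] along
    [iter k f], so weak and strict decrease transfer point by point. *)
Lemma iter_strict_lyapunov (R : realType) (M : topologicalType) (f : M -> M)
    (k : nat) (u : M -> R) :
  continuous f -> strict_lyapunov (iter k f) u ->
  exists v : M -> R, strict_lyapunov f v.
Proof.
move=> cf [[cu u_le] [x u_lt]].
pose v y := \sum_(i < k) u (iter i f y).
have vB y : v (f y) - v y = u (iter k f y) - u y.
  rewrite /v -(telescope_sumr (fun i => u (iter i f y)) (leq0n k)) big_mkord.
  by rewrite -sumrB; apply: eq_bigr => i _; rewrite -iterSr.
exists v; split; first split.
- move=> y; rewrite /v.
  apply: (@cvg_big R 'I_k +%R 0 predT add_continuous _ (nbhs y) (index_enum 'I_k)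
    (fun i z => u (iter i f z)) (fun i => u (iter i f y))) => i _.
  by apply: (@continuous_comp _ _ _ (iter i f) u);
    [exact: (@continuous_iter _ f i cf y)|exact: cu].
- by move=> y; rewrite -subr_le0 vB subr_le0.
- by exists x; rewrite -subr_lt0 vB subr_lt0.
Qed.

(** A point of [K] outside [W] is where the Lyapunov function will drop strictly; its existence also
    rules out [k = 0]. *)
Definition trapping (M : topologicalType) (f : M -> M) : Prop :=
  exists k (K W : set M), [/\ closed K, open W, W `<=` K, K `\` W !=set0
    & iter k f @` K `<=` W].

(** Points of [K] are sent to the minimum 0 of [u], and points off [K], being off [W], start at its
    maximum 1. At a point of [K] outside [W] the value falls from 1 to 0. *)
Lemma trapping_strict_lyapunov (R : realType) (M : topologicalType)
    (f : M -> M) :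
  hausdorff_space M -> compact [set: M] -> continuous f -> trapping f ->
  exists u : M -> R, strict_lyapunov f u.
Proof.
move=> hM cM cf [k [K [W [Kcl Wop WK [x [Kx Wx]] fKW]]]].
have cfk : continuous (iter k f) by exact: continuous_iter.
have fK_closed : closed (iter k f @` K).
  apply: compact_closed => //; apply: continuous_compact.
    exact: continuous_subspaceT.
  exact: (subclosed_compact Kcl cM).
have sep : uniform_separator (iter k f @` K) (~` W).
  apply: normal_uniform_separator => //.
  - exact: compact_normal.
  - exact: open_closedC.
  - by apply/seteqP; split=> // y [/fKW].
pose u : M -> R := Urysohn (iter k f @` K) (~` W).
have u0 y : K y -> u (iter k f y) = 0.
  by move=> Ky; apply: (Urysohn_sub0 sep); exists (iter k f y) => //; exists y.
have u1 y : ~ W y -> u y = 1.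
  by move=> Wy; apply: (Urysohn_sub1 sep); exists y.
have u01 y : 0 <= u y <= 1.
  have /Urysohn_range : range u (u y) by exists y.
  by rewrite /= in_itv.
apply: (@iter_strict_lyapunov _ _ _ k u) => //.
split; first split.
- exact: Urysohn_continuous.
- move=> y; have [Ky|/(contra_not (WK y)) Wy] := pselect (K y).
    by rewrite u0//; case/andP: (u01 y).
  by rewrite (u1 y)//; case/andP: (u01 (iter k f y)).
- by exists x; rewrite u0// u1// ltr01.
Qed.

(** * Openness of the trapping condition *)

Section openness.
Context (R : realType) (M : metricType R) (cM : compact [set: M]).

(** Continuity of [f] at [x] accounts for half of [e]; the other half comes from the uniform
    distance, which does not see where [p.2] is. *)
Lemma homeo_eval_cvg (f : homeo_space cM) (x : M) :
  (fun p : homeo_space cM * M => (p.1 : homeo M) p.2) @ (f, x) -->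
    (f : homeo M) x.
Proof.
apply/metricType_numDomainType.cvgrPdist_lt => e e0.
have e2 : 0 < e / 2 by rewrite divr_gt0.
have /metricType_numDomainType.cvgrPdist_lt/(_ _ e2) fx :=
  @homeo_fun_continuous _ (f : homeo M) x.
near=> p.
rewrite (splitr e) (le_lt_trans (metric_triangle _ ((f : homeo M) p.2) _))//.
apply: ltrD.
  near: p.
  exact: (@cvg_snd _ _ (nbhs f) (nbhs x) _ _ fx).
apply: (@le_lt_trans _ _ (homeo_dist f p.1)).
  by apply: le_trans (homeo_pdist_le cM f p.1 p.2); rewrite le_max lexx.
have : ball f (e / 2) p.1.
  near: p.
  exact: (@cvg_fst _ _ (nbhs f) (nbhs x) _ _ (nbhsx_ballx f _ e2)).
by rewrite ballEmdist.
Unshelve. all: by end_near. Qed.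

Lemma homeo_iter_cvg (k : nat) (f : homeo_space cM) (x : M) :
  (fun p : homeo_space cM * M => iter k (p.1 : homeo M) p.2) @ (f, x) -->
    iter k (f : homeo M) x.
Proof.
elim: k => [|k IHk] /=; first exact: cvg_snd.
apply: (@cvg_comp _ _ _
  (fun p : homeo_space cM * M => (p.1, iter k (p.1 : homeo M) p.2))
  (fun p : homeo_space cM * M => (p.1 : homeo M) p.2) (nbhs (f, x))
  (nbhs (f, iter k (f : homeo M) x))); last exact: homeo_eval_cvg.
apply: (@cvg_pair _ _ _ (nbhs (f, x)) (nbhs f) (nbhs (iter k (f : homeo M) x))
  _ _ _ (fun p : homeo_space cM * M => p.1)); [exact: cvg_fst|exact: IHk].
Qed.

Lemma open_trapping : open [set f : homeo_space cM | trapping (f : homeo M)].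
Proof.
rewrite openE => f [k [K [W [Kcl Wop WK KW fKW]]]].
(* The triple [k], [K], [W] is kept for nearby [g]: compactness of [K] merges the local conditions
   given by joint continuity into a single ball around [f]. *)
have /compact_near_coveringP Kcov := subclosed_compact Kcl cM (@subsetT _ K).
have := Kcov _ (nbhs f) (fun g : homeo_space cM => iter k (g : homeo M) @^-1` W) _.
case=> [x Kx|].
  have fxW : nbhs (iter k (f : homeo M) x) W.
    by apply: open_nbhs_nbhs; split=> //; apply: fKW; exists x.
  have [[A B]/= [fA xB] ABW] := homeo_iter_cvg fxW.
  by exists (B, A) => // -[y g]/= [By Ag]; exact: (ABW (g, y)).
move=> e e0 He; exists e => // g /He gKW.
by exists k, K, W; split=> // _ [x Kx <-]; exact: gKW.
Qed.

End openness.

(** * Radial squeezing homeomorphisms of a normed space *)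

Section squeeze.
Context (R : realType) (V : normedModType R) (b : V) (s : R).
Hypothesis s_gt0 : 0 < s.

(* On the ball of radius s, the radial part of [squeeze l] is the Moebius map
   t |-> l t / (1 + (l - 1) t) of [0, 1] (in units of s), whose inverse is the
   one with parameter 1 / l. *)
Definition squeeze_rate (l t : R) : R := l / (1 + (l - 1) * Num.min t 1).

Definition squeeze (l : R) (x : V) : V :=
  b + squeeze_rate l (`|x - b| / s) *: (x - b).

(** The denominator is a convex combination of 1 and [l], with weight [Num.min t 1] on [l]. *)
Lemma squeeze_den_gt0 (l t : R) : 0 < l -> 0 <= t ->
  0 < 1 + (l - 1) * Num.min t 1.
Proof.
move=> l0 t0; rewrite minEle; have [t1|t1] := leP t 1; last lra.
by have [l1|l1] := leP l 1; nra.
Qed.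

Lemma squeeze_rate_gt0 (l t : R) : 0 < l -> 0 <= t -> 0 < squeeze_rate l t.
Proof. by move=> l0 t0; rewrite divr_gt0// squeeze_den_gt0. Qed.

(** The truncation freezes the denominator at [l], so the squeeze glues continuously to the identity
    outside the ball. *)
Lemma squeeze_rate1 (l t : R) : 0 < l -> 1 <= t -> squeeze_rate l t = 1.
Proof.
move=> l0 t1; rewrite /squeeze_rate min_r// mulr1 addrCA subrr addr0.
by rewrite divff// gt_eqF.
Qed.

Lemma squeeze_rateV (l t : R) : 0 < l -> 0 <= t ->
  squeeze_rate l^-1 (squeeze_rate l t * t) * squeeze_rate l t = 1.
Proof.
move=> l0 t0; have [t1|/ltW t1] := leP 1 t.
  by rewrite (squeeze_rate1 l0 t1) mul1r squeeze_rate1 ?mulr1 ?invr_gt0.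
have den0 := squeeze_den_gt0 l0 t0.
rewrite /squeeze_rate (min_l t1) in den0 *.
(* The Moebius map preserves [0, 1], so the second rate is not truncated either. *)
rewrite min_l; last by rewrite mulrAC ler_pdivrMr//; nra.
by field; rewrite ?gt_eqF//=; nra.
Qed.

Lemma squeeze_out (l : R) (x : V) : 0 < l -> s <= `|x - b| -> squeeze l x = x.
Proof.
move=> l0 xs; rewrite /squeeze squeeze_rate1//.
  by rewrite scale1r subrKC.
by rewrite ler_pdivlMr// mul1r.
Qed.

Lemma norm_squeezeB (l : R) (x : V) : 0 < l ->
  `|squeeze l x - b| = squeeze_rate l (`|x - b| / s) * `|x - b|.
Proof.
move=> l0; rewrite /squeeze addrC addKr normrZ gtr0_norm//.
by rewrite squeeze_rate_gt0// divr_ge0// ltW.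
Qed.

Lemma squeezeK (l : R) : 0 < l -> cancel (squeeze l) (squeeze l^-1).
Proof.
move=> l0 x; rewrite {1}/squeeze norm_squeezeB// -[_ * _ / s]mulrA.
rewrite /squeeze [b + _ - b]addrC addKr scalerA squeeze_rateV//.
  by rewrite scale1r subrKC.
by rewrite divr_ge0// ltW.
Qed.

Lemma continuous_squeeze (l : R) : 0 < l -> continuous (squeeze l).
Proof.
move=> l0 x.
have cB : (fun y : V => y - b) @ x --> x - b.
  by apply: cvgB; [exact: cvg_id|exact: cvg_cst].
have ct : (fun y : V => `|y - b| / s) @ x --> `|x - b| / s.
  by apply: cvgMl; exact: cvg_norm.
apply: cvgD; first exact: cvg_cst.
apply: cvgZ => //; apply: cvgM; first exact: cvg_cst.
apply: cvgV.
  by rewrite gt_eqF// squeeze_den_gt0// divr_ge0// ltW.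
apply: cvgD; first exact: cvg_cst.
apply: cvgM; first exact: cvg_cst.
apply: (@continuous_min _ _ (fun y : V => `|y - b| / s) (fun=> 1) x) => //.
exact: cvg_cst.
Qed.

Lemma exists_squeeze (r d : R) : 0 < r < s -> 0 < d ->
  exists D : homeo V, (forall x, s <= `|x - b| -> D x = x) /\
    (forall x, `|x - b| <= r -> `|D x - b| < d).
Proof.
move=> /andP[r0 rs] d0.
(* For [t <= r / s] the denominator is at least [1 - r / s], so the new radius is at most
   [l * t * s / (1 - r / s) = d * t / 2], which is less than [d]. *)
pose l := d * (1 - r / s) / (2 * s).
have rs1 : r / s < 1 by rewrite ltr_pdivrMr// mul1r.
have l0 : 0 < l by rewrite divr_gt0 ?mulr_gt0 ?subr_gt0.
have lV0 : 0 < l^-1 by rewrite invr_gt0.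
have lVK : cancel (squeeze l^-1) (squeeze l).
  by move=> x; rewrite -{1}(invrK l) squeezeK.
exists (Homeo (squeezeK l0) lVK (continuous_squeeze l0)
  (continuous_squeeze lV0)); split=> x /=; first exact: squeeze_out.
move=> xr; rewrite norm_squeezeB//.
set t := `|x - b| / s.
have t0 : 0 <= t by rewrite divr_ge0// ltW.
have tr : t <= r / s by rewrite ler_pM2r// invr_gt0.
have den0 := squeeze_den_gt0 l0 t0.
rewrite (_ : `|x - b| = t * s); last by rewrite /t divfK// gt_eqF.
rewrite /squeeze_rate min_l in den0 *; last lra.
rewrite mulrAC ltr_pdivrMr//.
have -> : l * (t * s) = d * ((1 - r / s) * t / 2).
  by rewrite /l; field; rewrite gt_eqF.
rewrite ltr_pM2l//; move: tr rs1 l0 t0; clearbody t l.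
by move: (r / s) => q *; nra.
Qed.

End squeeze.

(** * Transport of compactly supported homeomorphisms through a chart *)

Section chart_transport.
Context (R : realType) (n : nat) (M : topologicalType) (c : chart R n M).
Hypothesis hM : hausdorff_space M.

Lemma compact_chart_inv (S : set 'rV[R]_n) : compact S ->
  S `<=` chart_cod c -> compact (chart_inv c @` S).
Proof.
move=> cS Scod; apply: continuous_compact => //.
apply: continuous_in_subspaceT => y /set_mem/Scod/mem_set.
exact: chart_inv_continuous.
Qed.

Lemma open_chart_preimage (A : set 'rV[R]_n) : open A ->
  open (chart_dom c `&` c @^-1` A).
Proof.
rewrite !openE => Aop x [cx Ax].
apply: filterI; first by apply: open_nbhs_nbhs; split=> //; exact: open_chart_dom.
by apply: (@chart_fun_continuous _ _ _ c x); [exact: mem_set|exact: Aop].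
Qed.

Definition chart_transport (D : 'rV[R]_n -> 'rV[R]_n) (x : M) : M :=
  if pselect (chart_dom c x) then chart_inv c (D (c x)) else x.

Context (S : set 'rV[R]_n) (cS : compact S) (Scod : S `<=` chart_cod c).
Implicit Types D : 'rV[R]_n -> 'rV[R]_n.

(** If [D y] is outside [S], then [D] fixes it, and injectivity gives [D y = y]. *)
Lemma support_stable D : injective D -> (forall y, ~ S y -> D y = y) ->
  forall y, chart_cod c y -> chart_cod c (D y).
Proof.
move=> Dinj Dout y cy; have [DS|DS] := pselect (S (D y)); first exact: Scod.
by rewrite (Dinj _ _ (Dout _ DS)).
Qed.

Lemma chart_transport_out D : (forall y, ~ S y -> D y = y) ->
  forall x, ~ (chart_inv c @` S) x -> chart_transport D x = x.
Proof.
move=> Dout x Sx; rewrite /chart_transport; case: pselect => // cx.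
rewrite Dout ?chart_funK//; first exact: mem_set.
by move=> Scx; apply: Sx; exists (c x); rewrite ?chart_funK//; exact: mem_set.
Qed.

Lemma chart_transportK D D' : cancel D D' -> (forall y, ~ S y -> D y = y) ->
  cancel (chart_transport D) (chart_transport D').
Proof.
move=> DK Dout x; rewrite {2}/chart_transport; case: pselect => /= cx.
  have cDx : chart_cod c (D (c x)).
    by apply: support_stable => //; [exact: can_inj DK|exact: chart_funS].
  rewrite /chart_transport.
  case: pselect => [/= _|[]]; last exact: chart_invS.
  by rewrite chart_invK ?mem_set// DK chart_funK// mem_set.
by rewrite /chart_transport; case: pselect.
Qed.

(** Inside the chart domain this is a composition of continuous maps. A point outside it avoids the
    image of [S], which is compact, hence closed, so the map is the identity nearby. *)
Lemma continuous_chart_transport D : injective D ->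
  (forall y, ~ S y -> D y = y) -> continuous D ->
  continuous (chart_transport D).
Proof.
move=> Dinj Dout Dcont x; have [cx|cx] := pselect (chart_dom c x).
  have cDx : chart_cod c (D (c x)).
    by apply: support_stable => //; exact: chart_funS.
  have Dx : chart_transport D x = chart_inv c (D (c x)).
    by rewrite /chart_transport; case: pselect.
  rewrite /continuous_at Dx.
  apply: (@cvg_trans _ ((fun y => chart_inv c (D (c y))) @ x)).
    apply: near_eq_cvg; near=> y; rewrite /chart_transport.
    case: pselect => // -[]; near: y.
    by apply: open_nbhs_nbhs; split=> //; exact: open_chart_dom.
  apply: (@cvg_comp _ _ _ (fun y => D (c y)) (chart_inv c) _ (nbhs (D (c x)))).
    apply: (@cvg_comp _ _ _ c D _ (nbhs (c x))); last exact: Dcont.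
    by apply: chart_fun_continuous; exact: mem_set.
  by apply: chart_inv_continuous; exact: mem_set.
have Sx : ~ (chart_inv c @` S) x.
  by move=> [y Sy yx]; apply: cx; rewrite -yx; apply: chart_invS; exact: Scod.
rewrite /continuous_at (chart_transport_out Dout Sx).
apply: (@cvg_trans _ (id @ x)); last exact: cvg_id.
apply: near_eq_cvg; near=> y; rewrite (chart_transport_out Dout)//; near: y.
apply: open_nbhs_nbhs; split=> //; apply: closed_openC.
by apply: compact_closed => //; exact: compact_chart_inv.
Unshelve. all: by end_near. Qed.

Lemma exists_chart_homeo (D : homeo 'rV[R]_n) : (forall y, ~ S y -> D y = y) ->
  exists h : homeo M,
    (forall x, chart_dom c x -> h x = chart_inv c (D (c x))) /\
    (forall x, ~ (chart_inv c @` S) x -> h x = x).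
Proof.
move=> Dout.
have D'out y : ~ S y -> homeo_inv D y = y.
  by move=> Sy; rewrite -{1}(Dout y Sy) homeo_funK.
exists (Homeo
  (chart_transportK (@homeo_funK _ D) Dout)
  (chart_transportK (@homeo_invK _ D) D'out)
  (continuous_chart_transport (can_inj (@homeo_funK _ D)) Dout
    (@homeo_fun_continuous _ D))
  (continuous_chart_transport (can_inj (@homeo_invK _ D)) D'out
    (@homeo_inv_continuous _ D))).
split=> x /= cx; last exact: chart_transport_out.
by rewrite /chart_transport; case: pselect.
Qed.

End chart_transport.

(** * Coordinate balls and small perturbations of a homeomorphism *)

Lemma open_norm_ball (R : realType) (V : normedModType R) (b : V) (r : R) :
  open [set y | `|y - b| < r].
Proof.
have -> : [set y | `|y - b| < r] = ball b r.
  by rewrite -ball_normE; apply/seteqP; split=> y /=; rewrite distrC.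
exact: ball_open.
Qed.

Lemma compact_norm_ball (R : realType) (n : nat) (b : 'rV[R]_n) (r : R) :
  compact [set y | `|y - b| <= r].
Proof.
have -> : [set y | `|y - b| <= r] = closed_ball_ Num.norm b r.
  by apply/seteqP; split=> y /=; rewrite distrC.
apply: bounded_closed_compact; last exact: closed_closed_ball_.
exists (`|b| + r); split=> [|t rt y /= ybr]; first exact: num_real.
apply: le_trans (ltW rt); rewrite -(subrK b y) addrC.
by apply: le_trans (ler_normD _ _) _; rewrite lerD2l distrC.
Qed.

(** Supplies the point of the closed tiny ball outside the open one; [const_mx 1] is a nonzero
    direction once there is a coordinate. *)
Lemma exists_norm_eq (R : realType) (n : nat) (b : 'rV[R]_n) (d : R) :
  (0 < n)%N -> 0 <= d -> exists y, `|y - b| = d.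
Proof.
move=> n0 d0; pose v : 'rV[R]_n := const_mx 1.
have v0 : `|v| != 0.
  rewrite normr_eq0; apply/eqP => /rowP/(_ (Ordinal n0)).
  by rewrite !mxE => /eqP; rewrite oner_eq0.
exists (b + (d / `|v|) *: v); rewrite addrC addKr normrZ normrM normfV normr_id.
by rewrite divfK// ger0_norm.
Qed.

Definition homeo_comp (M : topologicalType) (h f : homeo M) : homeo M.
Proof.
apply: (@Homeo M (h \o f) (homeo_inv f \o homeo_inv h)).
- by move=> x /=; rewrite !homeo_funK.
- by move=> x /=; rewrite !homeo_invK.
- move=> x; apply: continuous_comp; exact: homeo_fun_continuous.
- move=> x; apply: continuous_comp; exact: homeo_inv_continuous.
Defined.

(** Both [h] and its inverse preserve [A]. Hence the maps differ only by moving points within [A],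
    and their inverses only by moving points within the preimage of [A] under [f]. *)
Lemma homeo_dist_comp_lt (R : realType) (M : metricType R) (A : set M)
    (f h : homeo M) (e : R) :
  compact [set: M] -> [set: M] !=set0 -> 0 < e ->
  (forall x, ~ A x -> h x = x) ->
  (forall x y, A x -> A y -> mdist x y < e) ->
  (forall x y, A x -> A y -> mdist (homeo_inv f x) (homeo_inv f y) < e) ->
  homeo_dist f (homeo_comp h f) < e.
Proof.
move=> cM M0 e0 hA Ae fAe.
have [x -> _] := homeo_dist_max cM f (homeo_comp h f) M0.
rewrite /homeo_pdist gt_max /=; apply/andP; split.
  have [Afx|Afx] := pselect (A (f x)); last by rewrite hA// mdistxx.
  apply: Ae => //; apply: contrapT => Ahfx; apply: (Ahfx).
  by rewrite -[h _](homeo_funK h) (hA _ Ahfx) homeo_funK.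
have [Ax|Ax] := pselect (A x).
  apply: fAe => //; apply: contrapT => Ahx; apply: (Ahx).
  by rewrite -(hA _ Ahx) homeo_invK.
by rewrite -{2}(hA _ Ax) homeo_funK mdistxx.
Qed.

(** * Density of the trapping condition *)

Lemma compact_orbit_recurrent (M : topologicalType) (f : M -> M) (x : M) :
  compact [set: M] ->
  exists m : M, forall A, nbhs m A -> forall N, exists2 i, (N <= i)%N & A (iter i f x).
Proof.
move=> cM.
(* A cluster point of the orbit along the filter at infinity, which contains every tail of the
   orbit. *)
have [m [_ cm]] := cM ((fun i => iter i f x) @ \oo) _ filterT.
exists m => A mA N.
have NF : ((fun i => iter i f x) @ \oo) [set iter i f x | i in [set i | (N <= i)%N]].
  by exists N => // i /= Ni; exists i.
by have [_ [[i /= Ni <-] Ai]] := cm _ _ NF mA; exists i.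
Qed.

(** Up to the first return the orbit misses the support of [h], so [h] acts only once, at time [k],
    and brings the returning point back into the tiny ball. *)
Lemma trapping_perturbation (R : realType) (n : nat) (M : topologicalType)
    (c : chart R n M) (f : homeo M) (z : M) (rho : R) (k : nat) :
  hausdorff_space M -> (0 < n)%N -> chart_dom c z ->
  [set y | `|y - c z| < rho] `<=` chart_cod c ->
  (0 < k)%N -> (chart_dom c `&` c @^-1` [set y | `|y - c z| < rho]) (iter k f z) ->
  exists2 h : homeo M,
    forall x, ~ (chart_inv c @` [set y | `|y - c z| < rho]) x -> h x = x &
    trapping (homeo_comp h f).
Proof.
move=> hM n0 cz rho_cod k0 kz.
(* The given [k] is replaced by the first return time of [z] to the ball of radius [rho]. *)
pose ret k := `[< (0 < k)%N /\
  (chart_dom c `&` c @^-1` [set y | `|y - c z| < rho]) (iter k f z) >].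
have exk : exists k, ret k by exists k; apply/asboolP.
have [{k0 kz exk}k /asboolP[k0 [fkz fkz_rho]] kmin] := ex_minnP exk.
set b := c z in rho_cod ret kmin fkz_rho *.
set p := iter k f z in fkz fkz_rho *.
rewrite /= in fkz_rho.
have p0 : 0 <= `|c p - b| by [].
(* Radii with [|c p - b| < r < s < rho], positive even if [p] is [z]: the squeeze is supported in
   radius [s] and contracts radius [r]. *)
pose r := (2 * `|c p - b| + rho) / 3.
pose s := (r + rho) / 2.
have pr : `|c p - b| < r by rewrite /r; lra.
have r0 : 0 < r by rewrite /r; lra.
have rs : r < s by rewrite /s /r; lra.
have srho : s < rho by rewrite /s /r; lra.
have s0 : 0 < s by apply: lt_trans rs.
pose S := [set y | `|y - b| <= s].
have cS : compact S by exact: compact_norm_ball.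
have Srho : S `<=` [set y | `|y - b| < rho].
  by move=> y /= yS; exact: le_lt_trans srho.
have Scod : S `<=` chart_cod c by exact: subset_trans rho_cod.
have S_closed : closed (chart_inv c @` S).
  by apply: compact_closed => //; exact: compact_chart_inv.
(* The features of the first return that persist near [z]. Time 0 is left out: [z] lies in the
   support, but [h] acts only after [f]. *)
pose good x :=
  (forall j, (0 < j < k)%N -> ~ (chart_inv c @` S) (iter j f x)) /\
  (chart_dom c `&` c @^-1` [set y | `|y - b| < r]) (iter k f x).
have near_iter j (A : set M) : open A -> A (iter j f z) ->
    \forall x \near z, A (iter j f x).
  move=> Aop Afz.
  apply: (@continuous_iter _ f j (@homeo_fun_continuous _ f) z).
  by apply: open_nbhs_nbhs.
have near_z : \forall x \near z, good x.
  apply: filterI; last first.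
    by apply: near_iter => //; exact: open_chart_preimage (open_norm_ball _ _).
  suff : \forall x \near z, forall j : 'I_k, (0 < j)%N ->
      ~ (chart_inv c @` S) (iter j f x).
    by apply: filterS => x xP j /andP[j0 jk]; exact: (xP (Ordinal jk)).
  apply: filter_forall => j; have [j0|j0] := posnP j.
    by apply: nearW => x; rewrite j0.
  suff : \forall x \near z, (~` (chart_inv c @` S)) (iter j f x).
    by apply: filterS => x xS _.
  apply: near_iter; first exact: closed_openC.
  (* A visit to the support at time [j] would be a return earlier than the minimal [k]. *)
  move=> [y Sy yz]; have /negP[] : ~~ (j < k)%N; last exact: ltn_ord.
  rewrite -leqNgt; apply: kmin; apply/asboolP; split=> //=.
  rewrite -yz chart_invK ?mem_set//; last exact: Scod.
  by split; [exact/chart_invS/Scod|exact: Srho].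
have near_b : \forall y \near b, chart_cod c y /\ good (chart_inv c y).
  have cb : chart_cod c b by exact: chart_funS.
  apply: filterI; first by apply: open_nbhs_nbhs; split=> //; exact: open_chart_cod.
  apply: (chart_inv_continuous (mem_set cb)).
  by rewrite chart_funK ?mem_set.
have [d d0 dP] : exists2 d : R, 0 < d &
    forall y, `|y - b| <= d -> chart_cod c y /\ good (chart_inv c y).
  have /nbhs_ballP[e /= e0 eP] := near_b.
  exists (e / 2) => [|y yb]; first by rewrite divr_gt0.
  apply: eP; rewrite -ball_normE /= distrC (le_lt_trans yb)//.
  by rewrite ltr_pdivrMr// ltr_pMr// ltr1n.
have [|D [Dout Din]] := @exists_squeeze R _ b s s0 r d _ d0.
  by rewrite r0.
have {}Dout y : ~ S y -> D y = y.
  by move=> /negP; rewrite -ltNge => /ltW; exact: Dout.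
have [h [h_in h_out]] := exists_chart_homeo hM cS Scod Dout.
exists h => [x xrho|].
  by apply: h_out => -[y /Srho yS yx]; apply: xrho; exists y.
(* [K] and [W] are the closed and the open ball of radius [d], read in the chart. *)
exists k, (chart_inv c @` [set y | `|y - b| <= d]),
  (chart_dom c `&` c @^-1` [set y | `|y - b| < d]).
split.
- apply: compact_closed => //; apply: compact_chart_inv.
    exact: compact_norm_ball.
  by move=> y /dP[].
- exact: open_chart_preimage (open_norm_ball _ _).
- move=> x [cx /= xd]; exists (c x); first exact: ltW.
  by rewrite chart_funK// mem_set.
- have [y yd] := exists_norm_eq b n0 (ltW d0).
  have /dP[cy _] : `|y - b| <= d by rewrite yd.
  exists (chart_inv c y); split; first by exists y => //=; rewrite yd.
  by move=> [_] /=; rewrite chart_invK ?mem_set// yd ltxx.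
- move=> _ [_ [y /dP[cy [yS [fky fkyr]]] <-] <-].
  set x := chart_inv c y in yS fky fkyr *.
  have gf j : (j < k)%N -> iter j (homeo_comp h f) x = iter j f x.
    elim: j => // j IHj jk; rewrite iterS IHj ?(ltnW jk)//=.
    by apply: h_out; rewrite -iterS; apply: yS.
  have -> : iter k (homeo_comp h f) x = h (iter k f x).
    by case: (k) k0 gf => // k' _ gf; rewrite iterS gf.
  rewrite h_in//.
  have Dd := Din _ (ltW fkyr).
  have /dP[cD _] := ltW Dd.
  by split; [exact: chart_invS|rewrite /= chart_invK ?mem_set].
Qed.

(** The cluster point [m] fixes the chart and the scale. The perturbation is centred at an orbit
    point [z] near [m], since [m] itself need not return. *)
Lemma dense_trapping (R : realType) (n : nat) (M : metricType R)
    (cM : compact [set: M]) :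
  smooth_manifold R n M -> (0 < n)%N -> [set: M] !=set0 ->
  dense [set f : homeo_space cM | trapping (f : homeo M)].
Proof.
move=> smoothM n0 M0 O [f Of] Oop.
have hM := manifold_hausdorff smoothM.
have /nbhs_ballP[e /= e0 eO] : nbhs f O by exact: open_nbhs_nbhs.
have e2 : 0 < e / 2 by rewrite divr_gt0.
have [x0 _] := M0.
have [m mrec] := compact_orbit_recurrent (f : homeo M) x0 cM.
have [c _ cm] := atlas_cover smoothM m.
have ccm : chart_cod c (c m) by exact: chart_funS.
have inv_cvg : chart_inv c @ c m --> m.
  have := chart_inv_continuous (mem_set ccm).
  by rewrite /continuous_at chart_funK ?mem_set.
have near_m (v : M -> M) : continuous v ->
    \forall y \near c m, mdist (v m) (v (chart_inv c y)) < e / 2.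
  move=> cv; have := cvg_comp _ _ inv_cvg (cv m).
  by move=> /metricType_numDomainType.cvgrPdist_lt/(_ _ e2).
(* The chart ball and its preimage under [f] must both be small, as the distance also compares
   inverses. *)
have /nbhs_ballP[sigma /= sigma0 sigmaP] : \forall y \near c m,
    chart_cod c y /\ (mdist m (chart_inv c y) < e / 2 /\
      mdist (homeo_inv f m) (homeo_inv f (chart_inv c y)) < e / 2).
  apply: filterI.
    by apply: open_nbhs_nbhs; split=> //; exact: open_chart_cod.
  apply: filterI; first by apply: (near_m id) => x; exact: cvg_id.
  exact: near_m (@homeo_inv_continuous _ (f : homeo M)).
(* Two points within [s] of [c m] are less than [2 * s] apart, and the ball of radius [2 * s] around
   either stays within [3 * s < sigma] of [c m]. *)
pose s := sigma / 4.
have s0 : 0 < s by rewrite divr_gt0.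
pose N := chart_dom c `&` c @^-1` [set y | `|y - c m| < s].
have Nm : nbhs m N.
  apply: open_nbhs_nbhs; split; first exact: open_chart_preimage (open_norm_ball _ _).
  by split=> //=; rewrite subrr normr0.
have [i _ [ci Ni]] := mrec _ Nm 0%N.
(* Asking for a visit from time [i.+1] on makes [j - i] positive. *)
have [j ij [cj Nj]] := mrec _ Nm i.+1.
rewrite /= in Ni Nj.
set z := iter i (f : homeo M) x0 in ci Ni.
pose B := [set y | `|y - c z| < 2 * s].
have Bm y : B y -> ball (c m) sigma y.
  rewrite /B /= => yz; rewrite -ball_normE /= distrC -(subrKA (c z)).
  apply: le_lt_trans (ler_normD _ _) _.
  have sigmaE : sigma = 4 * s by rewrite /s; field.
  by rewrite sigmaE; lra.
have jz : iter (j - i) (f : homeo M) z = iter j (f : homeo M) x0.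
  by rewrite -iterD subnK// ltnW.
have [|||h h_out h_trap] := @trapping_perturbation R n M c f z (2 * s) (j - i) hM n0 ci.
- by move=> y /Bm/sigmaP[].
- by rewrite subn_gt0.
- rewrite jz; split=> //=; rewrite -(subrKA (c m)).
  apply: le_lt_trans (ler_normD _ _) _.
  by rewrite mulr2n mulrDl mul1r ltrD// distrC.
exists (homeo_comp h f); split => //; apply: eO; rewrite ballEmdist /=.
apply: (@homeo_dist_comp_lt _ _ (chart_inv c @` B)) => //.
- move=> _ _ [y /Bm/sigmaP[_ [ym _]] <-] [y' /Bm/sigmaP[_ [y'm _]] <-].
  apply: le_lt_trans (metric_triangle _ m _) _.
  by rewrite (splitr e) ltrD// metric_sym.
- move=> _ _ [y /Bm/sigmaP[_ [_ ym]] <-] [y' /Bm/sigmaP[_ [_ y'm]] <-].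
  apply: le_lt_trans (metric_triangle _ (homeo_inv f m) _) _.
  by rewrite (splitr e) ltrD// metric_sym.
Qed.

Theorem proposition5p3 (R : realType) (n : nat) (M : metricType R)
    (smoothM : smooth_manifold R n M) (compactM : compact [set: M])
    (n_gt0 : (0 < n)%N) (M_neq0 : [set: M] !=set0) :
  generic [set f : homeo_space compactM |
    exists u : M -> R, strict_lyapunov (f : homeo M) u].
Proof.
(* The trapping homeomorphisms already form one open dense set, so a constant sequence serves. *)
exists (fun=> [set f : homeo_space compactM | trapping (f : homeo M)]).
split=> [_|f /(_ 0%N I) f_trap].
  by split; [exact: open_trapping|exact: (@dense_trapping R n)].
apply: trapping_strict_lyapunov => //; first exact: manifold_hausdorff smoothM.
exact: homeo_fun_continuous.
Qed.
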